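(* For every real number $x>0$, $$\pi\,(3+8\sqrt{2})\cdot f(x) \;<\; \arctan x \;<\; 45\cdot f(x),$$ where $$ f(x) = \frac{x}{7+6\sqrt{1+x^2}+16\sqrt{2}\,\sqrt{1+x^2+\sqrt{1+x^2}}}. $$ *)

(* Defs.v *)
From Stdlib Require Import Reals.
Open Scope R_scope.

Definition atan_approx (x : R) : R :=
  x / (7 + 6 * sqrt (1 + x ^ 2)
       + 16 * sqrt 2 * sqrt (1 + x ^ 2 + sqrt (1 + x ^ 2))).

(* Main.v *)
Require Import Defs.
From Stdlib Require Import Reals.
From Stdlib Require Import Lra.
From Coquelicot Require Import Coquelicot.
Open Scope R_scope.

(** With [x = tan (2 t)], [0 < t < PI / 4] and [u = cos t], the square roots
    disappear: [atan_approx x = 2 g(t)], where [g = sin t cos t / D(u)] and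
    [D(u) = 14 u^2 + 32 u - 1].  One finds [g' = P(u) / D(u)^2] with
    [P(u) = 32 u^3 + 12 u^2 + 1], and
    [45 P - D^2 = (1 - u)^3 (196 u + 44) > 0], so [45 g(t) - t] increases
    from [0]: this is the upper bound.  For [K = PI (3 + 8 sqrt 2)] the function
    [K g(t) - t] vanishes at [0] and at [PI / 4]; since [D^2 / P] is increasing
    in [u], its derivative can only change sign from negative to positive, and
    it is negative in between: this is the lower bound. *)

Definition half_angle_den (u : R) : R := 14 * u ^ 2 + 32 * u - 1.

Definition half_angle_num (u : R) : R := 32 * u ^ 3 + 12 * u ^ 2 + 1.

Definition half_angle_approx (t : R) : R :=
  sin t * cos t / half_angle_den (cos t).

Lemma half_angle_den_pos (u : R) : 1 / 2 < u -> 0 < half_angle_den u.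
Proof. unfold half_angle_den; intros; nra. Qed.

Lemma half_angle_num_pos (u : R) : 0 < u -> 0 < half_angle_num u.
Proof.
intros hu; unfold half_angle_num.
assert (0 < u ^ 3) by (apply pow_lt; lra).
assert (0 < u ^ 2) by (apply pow_lt; lra).
lra.
Qed.

(** Both polynomials equal 45 at [u = 1], that is at [t = 0], so 45 is the value of [D^2 / P] there;
    the contact is of third order. *)
Lemma half_angle_gap (u : R) :
  45 * half_angle_num u - half_angle_den u ^ 2
  = (1 - u) ^ 3 * (196 * u + 44).
Proof. unfold half_angle_num, half_angle_den; ring. Qed.

(** Substituting [D^2 = 45 P - (1 - u)^3 (196 u + 44)] on both sides cancels the terms
    [45 P(u) P(v)]. What remains to prove is [(1 - u)^3 B < (1 - v)^3 A], which follows from [B < A]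
    and [1 - u < 1 - v]. *)
Lemma den_sq_over_num_increasing (v u : R) :
  1 / 2 < v -> v < u -> u < 1 ->
  half_angle_den v ^ 2 * half_angle_num u
  < half_angle_den u ^ 2 * half_angle_num v.
Proof.
intros hv hvu hu.
set (A := (196 * v + 44) * half_angle_num u).
set (B := (196 * u + 44) * half_angle_num v).
assert (hB : 0 < B).
{ apply Rmult_lt_0_compat; [lra | apply half_angle_num_pos; lra]. }
assert (hAB : B < A).
(* [A - B] is antisymmetric in [u] and [v], hence divisible by [u - v]. In the cofactor only [-196]
   is negative, and [528 * (u + v) > 528] outweighs it. *)
{ assert (e : A - B = (u - v) * (6272 * (u * v) * (u + v) + 2352 * (u * v) - 196
      + 1408 * (u ^ 2 + u * v + v ^ 2) + 528 * (u + v)))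
    by (unfold A, B, half_angle_num; ring).
  assert (0 < u * v) by nra.
  assert (0 < 6272 * (u * v) * (u + v)) by (apply Rmult_lt_0_compat; lra).
  assert (0 < u ^ 2) by nra.
  assert (0 < v ^ 2) by nra.
  assert (0 < A - B) by (rewrite e; apply Rmult_lt_0_compat; lra).
  lra. }
assert (hc : 0 < (1 - u) ^ 3) by (apply pow_lt; lra).
assert (hcc : (1 - u) ^ 3 <= (1 - v) ^ 3) by (apply pow_incr; lra).
assert (h : (1 - u) ^ 3 * B < (1 - v) ^ 3 * A) by nra.
assert (e : half_angle_den u ^ 2 * half_angle_num v
    - half_angle_den v ^ 2 * half_angle_num u
    = (1 - v) ^ 3 * A - (1 - u) ^ 3 * B)
  by (unfold A, B, half_angle_num, half_angle_den; ring).
lra.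
Qed.

Lemma cos_gt_half (t : R) : 0 <= t <= PI / 4 -> 1 / 2 < cos t.
Proof.
intros ht; assert (hpi := PI_RGT_0).
rewrite <- cos_PI3; apply cos_decreasing_1; lra.
Qed.

Lemma cos_lt_1 (t : R) : 0 < t <= PI / 4 -> cos t < 1.
Proof.
intros ht; assert (hpi := PI_RGT_0).
rewrite <- cos_0; apply cos_decreasing_1; lra.
Qed.

Lemma derivable_scaled_half_angle_approx (k t : R) :
  0 <= t <= PI / 4 ->
  derivable_pt_lim (fun t => k * half_angle_approx t - t) t
    (k * (half_angle_num (cos t) / half_angle_den (cos t) ^ 2) - 1).
Proof.
intros ht.
assert (hD := half_angle_den_pos _ (cos_gt_half t ht)).
apply is_derive_Reals.
unfold half_angle_approx, half_angle_num; unfold half_angle_den in *.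
auto_derive; [lra |].
assert (hs : sin t * sin t = 1 - cos t * cos t).
{ generalize (sin2_cos2 t); unfold Rsqr; lra. }
set (u := cos t) in *; set (s := sin t) in *.
assert (e : (s * s) * (u * (28 * u + 32)) = (1 - u * u) * (u * (28 * u + 32)))
  by (rewrite hs; reflexivity).
apply Rminus_diag_uniq.
(* The computed derivative and the claimed one differ by a multiple of [s * s - (1 - u * u)]; the
   factor [28 * u + 32] is [D'(u)]. *)
match goal with |- ?l = 0 =>
  replace l with (k * ((s * s) * (u * (28 * u + 32))
     - (1 - u * u) * (u * (28 * u + 32))
     + (s * s - (1 - u * u)) * -(14 * u ^ 2 + 32 * u - 1))
     / (14 * u ^ 2 + 32 * u - 1) ^ 2) by (field; lra)
end.
rewrite e, hs; field; lra.
Qed.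

Lemma MVT_scaled_half_angle_approx (k a b : R) :
  0 <= a -> a < b -> b <= PI / 4 ->
  exists c, (k * half_angle_approx b - b) - (k * half_angle_approx a - a)
    = (k * (half_angle_num (cos c) / half_angle_den (cos c) ^ 2) - 1) * (b - a)
    /\ a < c < b.
Proof.
intros ha hab hb.
apply (MVT_cor2 (fun t => k * half_angle_approx t - t)
  (fun t => k * (half_angle_num (cos t) / half_angle_den (cos t) ^ 2) - 1));
  [exact hab |].
intros c hc; apply derivable_scaled_half_angle_approx; lra.
Qed.

Lemma half_angle_approx_0 : half_angle_approx 0 = 0.
Proof. unfold half_angle_approx; rewrite sin_0; unfold Rdiv; ring. Qed.

(** This fixes the lower constant: [D(sqrt 2 / 2) = 6 + 16 sqrt 2] and [sin t cos t = 1 / 2] at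
    [PI / 4], the limit [x -> +oo]. *)
Lemma half_angle_approx_PI4 :
  PI * (3 + 8 * sqrt 2) * half_angle_approx (PI / 4) = PI / 4.
Proof.
unfold half_angle_approx, half_angle_den; rewrite sin_PI4, cos_PI4.
assert (h2 : sqrt 2 * sqrt 2 = 2) by (apply sqrt_sqrt; lra).
assert (h0 : 0 < sqrt 2) by (apply sqrt_lt_R0; lra).
replace (1 / sqrt 2) with (sqrt 2 / 2)
  by (apply (Rmult_eq_reg_r (2 * sqrt 2)); [field_simplify; nra | nra]).
replace (sqrt 2 / 2 * (sqrt 2 / 2)) with (1 / 2) by lra.
replace ((sqrt 2 / 2) ^ 2) with (1 / 2) by nra.
field; lra.
Qed.

Lemma half_angle_upper (t : R) :
  0 < t <= PI / 4 -> t < 45 * half_angle_approx t.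
Proof.
intros ht.
destruct (MVT_scaled_half_angle_approx 45 0 t) as [c [e hc]]; try lra.
rewrite half_angle_approx_0 in e.
assert (hu := cos_gt_half c ltac:(lra)).
assert (hu1 := cos_lt_1 c ltac:(lra)).
assert (hD := half_angle_den_pos _ hu).
assert (hG := half_angle_gap (cos c)).
assert (0 < (1 - cos c) ^ 3 * (196 * cos c + 44))
  by (apply Rmult_lt_0_compat; [apply pow_lt |]; lra).
assert (0 < 45 * (half_angle_num (cos c) / half_angle_den (cos c) ^ 2) - 1).
{ replace (45 * (half_angle_num (cos c) / half_angle_den (cos c) ^ 2) - 1)
    with ((45 * half_angle_num (cos c) - half_angle_den (cos c) ^ 2)
      / half_angle_den (cos c) ^ 2) by (field; lra).
  apply Rdiv_lt_0_compat; [lra | apply pow_lt; lra]. }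
nra.
Qed.

(** If [K g(t) >= t], the mean value theorem on [[0, t]] and on [[t, PI / 4]] gives points [a < b]
    with slope [>= 0] at [a] and [<= 0] at [b]. This contradicts the strict growth of [P / D^2] as
    [cos] decreases. *)
Lemma half_angle_lower (t : R) :
  0 < t < PI / 4 -> PI * (3 + 8 * sqrt 2) * half_angle_approx t < t.
Proof.
intros ht; apply Rnot_le_lt; intros hge.
assert (h4 := half_angle_approx_PI4).
set (K := PI * (3 + 8 * sqrt 2)) in *.
destruct (MVT_scaled_half_angle_approx K 0 t) as [a [ea ha]]; try lra.
destruct (MVT_scaled_half_angle_approx K t (PI / 4)) as [b [eb hb]]; try lra.
rewrite half_angle_approx_0 in ea; rewrite h4 in eb.
assert (hab : cos b < cos a) by (apply cos_decreasing_1; lra).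
assert (hb2 := cos_gt_half b ltac:(lra)).
assert (ha1 := cos_lt_1 a ltac:(lra)).
assert (hlt := den_sq_over_num_increasing _ _ hb2 hab ha1).
assert (hDa := half_angle_den_pos (cos a) ltac:(lra)).
assert (hDb := half_angle_den_pos (cos b) ltac:(lra)).
assert (hPa := half_angle_num_pos (cos a) ltac:(lra)).
assert (hPb := half_angle_num_pos (cos b) ltac:(lra)).
assert (hDa2 := pow_lt _ 2 hDa); assert (hDb2 := pow_lt _ 2 hDb).
set (Pa := half_angle_num (cos a)) in *; set (Pb := half_angle_num (cos b)) in *.
set (Da := half_angle_den (cos a) ^ 2) in *.
set (Db := half_angle_den (cos b) ^ 2) in *.
assert (ka : 1 <= K * (Pa / Da)) by nra.
assert (kb : K * (Pb / Db) <= 1) by nra.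
assert (hq : Pa / Da < Pb / Db).
{ apply (Rmult_lt_reg_r (Da * Db)); [nra |].
  replace (Pa / Da * (Da * Db)) with (Db * Pa) by (field; lra).
  replace (Pb / Db * (Da * Db)) with (Da * Pb) by (field; lra).
  exact hlt. }
assert (hqa : 0 < Pa / Da) by (apply Rdiv_lt_0_compat; lra).
assert (hK : 0 < K) by nra.
nra.
Qed.

(** The inner root is [1 / cos (2 t)]. The outer radicand is then [(1 + cos (2 t)) / cos (2 t)^2], a
    square up to the factor 2 because [1 + cos (2 t) = 2 (cos t)^2]; the [sqrt 2] in the definition
    absorbs that factor. *)
Lemma atan_approx_tan_double (t : R) :
  0 < t < PI / 4 -> atan_approx (tan (2 * t)) = 2 * half_angle_approx t.
Proof.
intros ht.
assert (hu := cos_gt_half t ltac:(lra)).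
assert (hc : 0 < cos (2 * t)) by (apply cos_gt_0; lra).
assert (hD := half_angle_den_pos _ hu).
assert (e2 : cos (2 * t) = 2 * cos t * cos t - 1) by apply cos_2a_cos.
assert (h2 : 0 < sqrt 2) by (apply sqrt_lt_R0; lra).
assert (h22 : sqrt 2 * sqrt 2 = 2) by (apply sqrt_sqrt; lra).
assert (hsec : 1 + tan (2 * t) ^ 2 = (/ cos (2 * t)) ^ 2).
{ assert (h := sin2_cos2 (2 * t)); unfold Rsqr in h.
  unfold tan.
  replace (1 + (sin (2 * t) / cos (2 * t)) ^ 2)
    with ((sin (2 * t) * sin (2 * t) + cos (2 * t) * cos (2 * t))
      * (/ cos (2 * t)) ^ 2) by (field; lra).
  rewrite h; ring. }
assert (hinv : 0 < / cos (2 * t)) by (apply Rinv_0_lt_compat; lra).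
assert (hroot : (/ cos (2 * t)) ^ 2 + / cos (2 * t)
    = (sqrt 2 * cos t / cos (2 * t)) ^ 2).
{ replace ((sqrt 2 * cos t / cos (2 * t)) ^ 2)
    with (sqrt 2 * sqrt 2 * (cos t * cos t) / cos (2 * t) ^ 2) by (field; lra).
  rewrite h22.
  replace (2 * (cos t * cos t)) with (cos (2 * t) + 1) by lra.
  field; lra. }
unfold atan_approx.
rewrite hsec, sqrt_pow2, hroot, sqrt_pow2; try lra.
2: { apply Rlt_le, Rdiv_lt_0_compat; nra. }
replace (16 * sqrt 2 * (sqrt 2 * cos t / cos (2 * t)))
  with (16 * (sqrt 2 * sqrt 2) * cos t / cos (2 * t)) by (field; lra).
rewrite h22; unfold half_angle_approx, tan; rewrite sin_2a.
(* This is the original denominator multiplied by [cos (2 * t)]. *)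
replace (half_angle_den (cos t)) with (7 * cos (2 * t) + 6 + 32 * cos t)
  by (unfold half_angle_den; rewrite e2; ring).
field; split; lra.
Qed.

Theorem mainTheorem1 (x : R) (hx : 0 < x) :
  PI * (3 + 8 * sqrt 2) * atan_approx x < atan x < 45 * atan_approx x.
Proof.
assert (ht : 0 < atan x / 2 < PI / 4).
{ assert (h := atan_increasing 0 x hx); rewrite atan_0 in h.
  assert (h' := atan_bound x); lra. }
assert (e := atan_approx_tan_double _ ht).
replace (2 * (atan x / 2)) with (atan x) in e by field.
rewrite tan_atan in e; rewrite e.
assert (hl := half_angle_lower _ ht).
assert (hu := half_angle_upper (atan x / 2) ltac:(lra)).
lra.
Qed.
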